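(* Let $m\ge2$, $k\ge1$, $g\ge0$ and $n=m+g(m-1)$. Let $t,t'$ be $m$-ary trees with $n$ leaves, with depths $(\delta^{l_1}(t),\dots,\delta^{l_m}(t))$ and $(\delta^{l_1}(t'),\dots,\delta^{l_m}(t'))$. Then $t$ and $t'$ are $k$-equivalent if and only if $$\sum_{i=1}^{m-1}(m-i)\,\delta^{l_i}(t)\equiv\sum_{i=1}^{m-1}(m-i)\,\delta^{l_i}(t')\pmod{k(m-1)},$$ where addition and congruence of $n$-tuples are componentwise.
   Context: An $m$-ary tree is a rooted tree in which each node has either $0$ or $m$ linearly ordered children; nodes without children are leaves, numbered $1,\dots,n$ from left to right. Each edge joining a node to its $i$-th child is labelled $l_i$; $\delta^{l_i}_j(t)$ is the number of edges labelled $l_i$ on the path from the root to leaf $j$, $\delta^{l_i}(t)=(\delta^{l_i}_1(t),\dots,\delta^{l_i}_n(t))$, and the depth of $t$ is $(\delta^{l_1}(t),\dots,\delta^{l_m}(t))$. Meet: $s_1\wedge\dots\wedge s_m$ is the tree whose root has $s_i$ as subtree at its $i$-th child; longer meets are left-nested, $s_1\wedge\dots\wedge s_{m+h(m-1)}=((\dots((s_1\wedge\dots\wedge s_m)\wedge s_{m+1}\wedge\dots\wedge s_{2m-1})\dots)\wedge\dots\wedge s_{m+h(m-1)})$. A right $k$-rotation at a node $v$ replaces a subtree $t_1\wedge\dots\wedge t_{j-1}\wedge(t_j\wedge\dots\wedge t_{j+k(m-1)})\wedge t_{j+k(m-1)+1}\wedge\dots\wedge t_{m+k(m-1)}$ rooted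 at $v$ ($1\le j\le m-1$, the $t_i$ arbitrary $m$-ary trees, possibly single nodes) by $t_1\wedge\dots\wedge t_j\wedge(t_{j+1}\wedge\dots\wedge t_{j+k(m-1)+1})\wedge t_{j+k(m-1)+2}\wedge\dots\wedge t_{m+k(m-1)}$; a left $k$-rotation is the inverse. Two trees with $n$ leaves are $k$-equivalent if one can be obtained from the other by a finite sequence of right and left $k$-rotations. *)

(* Defs.v *)
From mathcomp Require Import all_boot.
From Stdlib Require Import Relation_Operators.

Set Implicit Arguments.
Unset Strict Implicit.
Unset Printing Implicit Defensive.

(* [Node s] is a root with the ordered list [s] of subtrees; a leaf is
   [Node [::]]. *)
Inductive tree : Type := Node of seq tree.

Fixpoint mary (m : nat) (t : tree) : bool :=
  let: Node s := t in
  ((size s == 0) || (size s == m)) && all (mary m) s.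

(* The words of edge labels (i for the label l_i, i >= 1) read from the root
   down to each leaf, the leaves being listed from left to right. *)
Fixpoint leaf_paths (t : tree) : seq (seq nat) :=
  let: Node s := t in
  if nilp s then [:: [::]] else
  flatten [seq [seq p.1 :: w | w <- p.2]
          | p <- zip (iota 1 (size s)) [seq leaf_paths u | u <- s]].

Definition leaves (t : tree) : nat := size (leaf_paths t).

(* delta^{l_i}(t), as the sequence of its entries. *)
Definition delta (i : nat) (t : tree) : seq nat :=
  [seq count_mem i w | w <- leaf_paths t].

(* The left-nested meet of a list of m + h(m-1) trees. *)
Fixpoint meet (m h : nat) (s : seq tree) : tree :=
  if h is h'.+1 then meet m h' (Node (take m s) :: drop m s) else Node s.

(* In [right_rotation_root], a = t_1, ..., t_{j-1}; x = t_j;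
   b = t_{j+1}, ..., t_{j+k(m-1)}; y = t_{j+k(m-1)+1}; c is the rest.  The size
   conditions amount to 1 <= j <= m-1, and the inner meets have
   k(m-1) + 1 = m + (k-1)(m-1) arguments (k >= 1). *)
Inductive right_rotation (m k : nat) : tree -> tree -> Prop :=
| right_rotation_root (a b c : seq tree) (x y : tree) :
    all (mary m) (a ++ x :: b ++ y :: c) ->
    size b = k * (m - 1) ->
    size a + 2 + size c = m ->
    right_rotation m k
      (Node (a ++ meet m k.-1 (x :: b) :: y :: c))
      (Node (a ++ x :: meet m k.-1 (rcons b y) :: c))
| right_rotation_child (a c : seq tree) (u v : tree) :
    right_rotation m k u v ->
    right_rotation m k (Node (a ++ u :: c)) (Node (a ++ v :: c)).

Definition left_rotation (m k : nat) (u v : tree) : Prop :=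
  right_rotation m k v u.

Definition k_equivalent (m k : nat) : tree -> tree -> Prop :=
  clos_refl_trans tree
    (fun u v => right_rotation m k u v \/ left_rotation m k u v).

(* Main.v *)
Require Import Defs.
From mathcomp Require Import all_boot.
From Stdlib Require Import Relation_Operators.
From mathcomp Require Import zify.

(* Encode a tree by the word of its preorder traversal, [true] for an inner
   node and [false] for a leaf.  If C_j is the number of [true]s before the j-th
   [false] (counting j from 0), then
     j + \sum_i (m - i) delta^{l_i}_j = (m - 1) C_j,
   so the congruence modulo k (m - 1) is the congruence of the C_j modulo k.
   A right k-rotation turns P true^k X Q into P X true^k Q, X being the code of
   a subtree, and hence preserves the C_j modulo k.  Conversely, left
   k-rotations decrease the number of pairs (false, true) in this order, and a
   tree admits none of them exactly when every run of [true]s other than the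
   initial one is shorter than k.  All such runs can then be read off the C_j
   modulo k, and the initial one is determined by the number of leaves. *)

(** * Preorder codes of trees *)

(** Trees nest inside lists, so inductions use a companion statement [Q] on lists of siblings,
    applied to all children at once. *)
Lemma tree_seq_ind (P : tree -> Prop) (Q : seq tree -> Prop) :
    (forall s, Q s -> P (Node s)) -> Q [::] ->
    (forall t s, P t -> Q s -> Q (t :: s)) ->
  forall t, P t.
Proof.
move=> HN H0 HC; fix IH 1 => -[s]; apply: HN.
by elim: s => [|t s IHs] //; apply: HC.
Qed.

Fixpoint code (t : tree) : seq bool :=
  let: Node s := t in
  if nilp s then [:: false] else true :: flatten [seq code u | u <- s].

Lemma code_node (s : seq tree) :
  s <> [::] -> code (Node s) = true :: flatten (map code s).
Proof. by case: s. Qed.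

Lemma flatten_code_cons (t : tree) (s : seq tree) :
  flatten (map code (t :: s)) = code t ++ flatten (map code s).
Proof. by []. Qed.

Lemma mary_node (m : nat) (s : seq tree) :
  size s = m -> mary m (Node s) = all (mary m) s.
Proof. by move=> /= ->; rewrite eqxx orbT. Qed.

Lemma mary_nodeP {m : nat} {s : seq tree} :
  mary m (Node s) -> s <> [::] -> size s = m /\ all (mary m) s.
Proof. by case: s => //= x s /andP[/eqP-> ->]. Qed.

(** Every node but the root is one of the [m] children of an inner node. *)
Lemma count_code (m : nat) (t : tree) : mary m t ->
  count negb (code t) = (m - 1) * count id (code t) + 1.
Proof.
move: t; apply: (tree_seq_ind _ (fun s => all (mary m) s ->
  count negb (flatten (map code s)) =
  (m - 1) * count id (flatten (map code s)) + size s)) => //.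
- move=> [|x s] IH; first by rewrite /=; lia.
  move=> /mary_nodeP[//|sz ms]; rewrite code_node //=.
  rewrite (IH ms) sz mulnDr; move: sz => /=; lia.
- by rewrite /= muln0.
- move=> t s IHt IHs /= /andP[/IHt Ht /IHs Hs].
  rewrite !count_cat Ht Hs mulnDr; lia.
Qed.

(** Codes are self-delimiting: the first letter tells whether 0 or [m] subtrees follow. The suffixes
    [w] and [w'] let the induction pass from one sibling to the next. *)
Lemma code_inj_cat {m : nat} (t t' : tree) (w w' : seq bool) :
    mary m t -> mary m t' -> code t ++ w = code t' ++ w' ->
  t = t' /\ w = w'.
Proof.
move: t t' w w'.
apply: (tree_seq_ind _ (fun s => forall s' w w', size s = size s' ->
  all (mary m) s -> all (mary m) s' ->
  flatten (map code s) ++ w = flatten (map code s') ++ w' ->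
  s = s' /\ w = w')).
- move=> s IH [s'] w w'.
  case: s s' IH => [|x s] [|x' s'] IH; try by move=> _ _ /= [].
  move=> /mary_nodeP[//|sz ms] /mary_nodeP[//|sz' ms'].
  rewrite !code_node // => -[E].
  have sz_eq : size (x :: s) = size (x' :: s') by rewrite sz sz'.
  by have [-> ->] := IH _ w w' sz_eq ms ms' E.
- by move=> [|? ?] w w'.
- move=> t s IHt IHs [//|t' s'] w w' /= [sz] /andP[mt ms] /andP[mt' ms'].
  rewrite -!catA => /IHt[] // -> E.
  by have [-> ->] := IHs s' w w' sz ms ms' E.
Qed.

(** * Numbers of inner nodes preceding each leaf *)

Fixpoint trues_before (q : nat) (w : seq bool) : seq nat :=
  match w with
  | [::] => [::]
  | true :: w' => trues_before q.+1 w'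
  | false :: w' => q :: trues_before q w'
  end.

Lemma trues_before_cat (q : nat) (u v : seq bool) :
  trues_before q (u ++ v)
  = trues_before q u ++ trues_before (q + count id u) v.
Proof.
elim: u q => [|[] u IH] q /=; first by rewrite addn0.
- by rewrite IH add1n addSnnS.
- by rewrite IH add0n.
Qed.

Lemma size_trues_before (q : nat) (w : seq bool) :
  size (trues_before q w) = count negb w.
Proof. by elim: w q => [|[] w IH] q //=; rewrite IH. Qed.

Lemma count_true_nseq (k : nat) : count id (nseq k true) = k.
Proof. by rewrite count_nseq mul1n. Qed.

Lemma trues_before_nseq (q k : nat) (w : seq bool) :
  trues_before q (nseq k true ++ w) = trues_before (q + k) w.
Proof. by elim: k q => [|k IH] q /=; rewrite ?addn0 // IH addSnnS. Qed.

Definition trues_mod (k q : nat) (w : seq bool) : seq nat :=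
  [seq x %% k | x <- trues_before q w].

Lemma trues_modE (k q q' : nat) (w : seq bool) :
  q = q' %[mod k] -> trues_mod k q w = trues_mod k q' w.
Proof.
rewrite /trues_mod; elim: w q q' => [|[] w IH] q q' E //=.
- by apply: IH; rewrite -[q.+1]addn1 -[q'.+1]addn1 -modnDml E modnDml.
- by rewrite E (IH _ _ E).
Qed.

Lemma trues_mod_delete (k q : nat) (u v : seq bool) :
  trues_mod k q (u ++ nseq k true ++ v) = trues_mod k q (u ++ v).
Proof.
rewrite /trues_mod trues_before_cat trues_before_nseq trues_before_cat.
rewrite !map_cat; congr (_ ++ _).
by apply: trues_modE; rewrite modnDr.
Qed.

(** * Rotations as moves of a block of the code *)

Lemma size_meet_step (m h : nat) (s : seq tree) :
    0 < m -> size s = m + h.+1 * (m - 1) ->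
  size (Node (take m s) :: drop m s) = m + h * (m - 1).
Proof. by move=> m_gt0 sz; rewrite /= size_drop sz mulSn addKn; lia. Qed.

(** [meet] builds the innermost node first; this exposes the outermost one. *)
Lemma meet_node (m h : nat) (l r : seq tree) :
    0 < m -> size l = m + h * (m - 1) ->
  meet m h.+1 (l ++ r) = Node (meet m h l :: r).
Proof.
move=> m_gt0; elim: h l => [|h IH] l sz.
  have szl : size l = m by lia.
  by rewrite /= take_size_cat // drop_size_cat // take_oversize // szl.
have le_m_l : m <= size l by lia.
have dropE : drop m (l ++ r) = drop m l ++ r.
  by rewrite -{1}(cat_take_drop m l) -catA drop_size_cat // size_takel.
rewrite -[LHS]/(meet m h.+1 (Node (take m (l ++ r)) :: drop m (l ++ r))).
rewrite takel_cat // dropE -cat_cons IH //; exact: size_meet_step.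
Qed.

Lemma nseq_true_cons (n : nat) (w : seq bool) :
  nseq n true ++ true :: w = nseq n.+1 true ++ w.
Proof. by elim: n => //= n ->. Qed.

(** The [h.+1] nodes created by the meet form its leftmost branch, so preorder visits them before
    any tree of [s]. *)
Lemma code_meet (m h : nat) (s : seq tree) :
    0 < m -> size s = m + h * (m - 1) ->
  code (meet m h s) = nseq h.+1 true ++ flatten (map code s).
Proof.
move=> m_gt0; elim: h s => [|h IH] s sz.
  by apply: code_node => s0; rewrite s0 /= in sz; lia.
have sz_take : size (take m s) = m by rewrite size_takel; lia.
rewrite -nseq_true_cons [meet _ _ _]/= IH; last exact: size_meet_step.
rewrite flatten_code_cons code_node; last first.
  by move=> s0; rewrite s0 /= in sz_take; lia.
by rewrite cat_cons -flatten_cat -map_cat cat_take_drop.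
Qed.

Lemma mary_meet (m h : nat) (s : seq tree) :
  0 < m -> size s = m + h * (m - 1) -> mary m (meet m h s) = all (mary m) s.
Proof.
move=> m_gt0; elim: h s => [|h IH] s sz; first by apply: mary_node; lia.
rewrite [meet _ _ _]/= IH; last exact: size_meet_step.
rewrite -[all _ _]/(mary m (Node (take m s)) && all (mary m) (drop m s))
  mary_node; last by rewrite size_takel; lia.
by rewrite -all_cat cat_take_drop.
Qed.

Lemma size_inner_meet (m k : nat) :
  0 < m -> 0 < k -> (k * (m - 1)).+1 = m + k.-1 * (m - 1).
Proof. by case: k => // k m_gt0 _; rewrite mulSn /=; lia. Qed.

(** Both inner meets contribute the block of [k] letters [true]; only its position relative to [x],
    the code of t_j, changes. That [x] contains a leaf makes the number of inversions change
    strictly. *)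
Lemma code_right_rotation (m k : nat) (u v : tree) :
    0 < m -> 0 < k -> right_rotation m k u v -> exists p x q,
  [/\ code u = p ++ nseq k true ++ x ++ q,
      code v = p ++ x ++ nseq k true ++ q & 0 < count negb x].
Proof.
move=> m_gt0 k_gt0; elim=> {u v} [a b c x y mabc szb szac|a c u v _].
  have k1 : k = k.-1.+1 by lia.
  exists (true :: flatten (map code a)), (code x),
    (flatten (map code b) ++ code y ++ flatten (map code c)).
  rewrite !code_node; try by case: (a).
  have sz1 : size (x :: b) = m + k.-1 * (m - 1).
    by rewrite /= szb size_inner_meet.
  have sz2 : size (rcons b y) = m + k.-1 * (m - 1).
    by rewrite size_rcons szb size_inner_meet.
  rewrite !map_cat !flatten_cat !flatten_code_cons !code_meet // -k1.
  rewrite flatten_code_cons map_rcons flatten_rcons.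
  rewrite -!catA; split=> //.
  have mx : mary m x by move: mabc; rewrite all_cat /= => /and3P[].
  by rewrite (count_code _ _ mx) addn1.
move=> [p [x [q [Eu Ev x_gt0]]]].
exists (true :: flatten (map code a) ++ p), x, (q ++ flatten (map code c)).
rewrite !code_node; try by case: (a).
by rewrite !map_cat !flatten_cat !flatten_code_cons Eu Ev /= -!catA.
Qed.

Lemma mary_right_rotation (m k : nat) (u v : tree) :
  0 < m -> 0 < k -> right_rotation m k u v -> mary m u = mary m v.
Proof.
move=> m_gt0 k_gt0; elim=> {u v} [a b c x y mabc szb szac|a c u v _ E].
  rewrite !mary_node; try by rewrite size_cat /=; lia.
  rewrite !all_cat /= !mary_meet ?size_rcons /= ?szb ?size_inner_meet //.
  by rewrite all_rcons; move: mabc; rewrite all_cat /= all_cat /= =>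
    /and5P[-> -> -> -> ->].
by rewrite /= !size_cat !all_cat /= E.
Qed.

Lemma k_equivalent_sym (m k : nat) (t t' : tree) :
  k_equivalent m k t t' -> k_equivalent m k t' t.
Proof.
elim=> {t t'} [u v [uv|vu]|u|u v w _ vu _ wv].
- by apply: rt_step; right.
- by apply: rt_step; left.
- exact: rt_refl.
- exact: rt_trans wv vu.
Qed.

Lemma trues_mod_k_equivalent (m k : nat) (t t' : tree) :
    0 < m -> 0 < k -> k_equivalent m k t t' ->
  trues_mod k 0 (code t) = trues_mod k 0 (code t').
Proof.
move=> m_gt0 k_gt0.
have rot u v :
    right_rotation m k u v -> trues_mod k 0 (code u) = trues_mod k 0 (code v).
  (* Deleting the block from either code leaves the same word [p ++ x ++ q]. *)
  move=> /(code_right_rotation _ _ _ _ m_gt0 k_gt0)[p [x [q [-> -> _]]]].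
  by rewrite trues_mod_delete [in RHS]catA trues_mod_delete -catA.
by elim=> {t t'} [u v [/rot|/rot]|u|u v w _ -> _].
Qed.

(** * Normal forms for left rotations *)

(** The length of the leftmost branch, which is the length of the initial run of [true] in the
    code. *)
Fixpoint spine (t : tree) : nat :=
  let: Node s := t in if s is u :: _ then (spine u).+1 else 0.

Lemma meet_of_spine (m h : nat) (t : tree) :
    0 < m -> mary m t -> h < spine t ->
  exists l, [/\ size l = m + h * (m - 1), all (mary m) l & t = meet m h l].
Proof.
move=> m_gt0; elim: h t => [|h IH] [[//|u s]] /mary_nodeP[//|sz ms].
  by move=> _; exists (u :: s); rewrite sz mul0n addn0.
case/andP: (ms : mary m u && all (mary m) s) => mu {}ms lt_h_u.
rewrite /= ltnS in lt_h_u.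
have [l [szl ml E]] := IH _ mu lt_h_u.
exists (l ++ s); rewrite meet_node // -E size_cat szl all_cat ml ms.
by split=> //; move: sz; rewrite mulSn /=; lia.
Qed.

(** The normal forms. First children are exempt: a left rotation acts on a child that has a left
    neighbour. *)
Fixpoint short_spines (k : nat) (t : tree) : bool :=
  let: Node s := t in
  all (fun u => spine u < k) (behead s) && all (short_spines k) s.

Lemma not_all_split (T : Type) (p : pred T) (s : seq T) :
  ~~ all p s -> exists a x c, s = a ++ x :: c /\ ~~ p x.
Proof.
elim: s => //= x s IH; rewrite negb_and.
case px: (p x) => /=; last by exists [::], x, s; rewrite px.
by move=> /IH[a [y [c [-> py]]]]; exists (x :: a), y, c.
Qed.

Lemma left_rotation_exists (m k : nat) (t : tree) :
    0 < m -> 0 < k -> mary m t -> ~~ short_spines k t ->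
  exists u, left_rotation m k t u.
Proof.
move=> m_gt0 k_gt0; move: t.
apply: (tree_seq_ind _ (fun s => forall a v c, s = a ++ v :: c ->
  mary m v -> ~~ short_spines k v -> exists u, left_rotation m k v u)).
- move=> s IH ms; rewrite [short_spines _ _]/= negb_and.
  have [s0|[sz {}ms]] : s = [::] \/ size s = m /\ all (mary m) s.
  + by case: s ms {IH} => [|x s] ms; [left|right; apply: mary_nodeP ms _].
  + by rewrite s0.
  case/orP => /not_all_split[a [y [c [E Hy]]]]; last first.
    have [||u rot] := IH _ _ _ E => //.
      by move: ms; rewrite E all_cat /= => /and3P[].
    by exists (Node (a ++ u :: c)); rewrite E; apply: right_rotation_child.
  case: s => [|x0 s] in ms sz E {IH} *; first by case: (a) E.
  (* Since [y] is not the first child, it has a left neighbour, called [x] below; it plays the role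
     of t_j in the rotation. *)
  move: E => /= E; rewrite {}E -cat_cons lastI cat_rcons in ms sz *.
  move: (belast _ _) (last _ _) ms sz => {x0 s}a x ms sz.
  move: ms; rewrite all_cat => /= /and4P[ma mx my mc].
  have [|l] := meet_of_spine m k.-1 y m_gt0 my; first by lia.
  rewrite -size_inner_meet //; case/lastP: l => [|b z] [szl ml Ey] //.
  exists (Node (a ++ meet m k.-1 (x :: b) :: z :: c)); rewrite Ey.
  move: szl ml; rewrite size_rcons all_rcons => -[szb] /andP[mz mb].
  apply: right_rotation_root.
  + by rewrite all_cat /= all_cat /= ma mx mb mz mc.
  + exact: szb.
  + by move: sz; rewrite size_cat /=; lia.
- by case.
- move=> t s IHt IHs [|x a] v c [E1 E2]; first by rewrite -E1.
  exact: IHs E2.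
Qed.

(** * Termination of left rotations *)

Fixpoint inversions (w : seq bool) : nat :=
  match w with
  | [::] => 0
  | true :: w' => inversions w'
  | false :: w' => count id w' + inversions w'
  end.

Lemma inversions_cat (u v : seq bool) :
  inversions (u ++ v)
  = inversions u + inversions v + count negb u * count id v.
Proof. elim: u => [|[] u IH] /=; rewrite ?count_cat ?IH; lia. Qed.

Lemma inversions_nseq (k : nat) : inversions (nseq k true) = 0.
Proof. by elim: k. Qed.

Lemma inversions_left_rotation (m k : nat) (t u : tree) :
    0 < m -> 0 < k -> left_rotation m k t u ->
  inversions (code u) < inversions (code t).
Proof.
move=> m_gt0 k_gt0.
move=> /(code_right_rotation _ _ _ _ m_gt0 k_gt0)[p [x [q [-> -> x_gt0]]]].
(* The two numbers differ by [k * count negb x]. *)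
rewrite !inversions_cat !count_cat !inversions_nseq !count_nseq /=.
nia.
Qed.

Lemma short_spines_exists (m k : nat) (t : tree) :
    0 < m -> 0 < k -> mary m t ->
  exists u, [/\ mary m u, short_spines k u & k_equivalent m k t u].
Proof.
move=> m_gt0 k_gt0; have [n] := ubnP (inversions (code t)).
elim: n t => // n IH t lt_t_n mt.
have [nf|/(left_rotation_exists _ _ _ m_gt0 k_gt0 mt)[v tv]] :=
  boolP (short_spines k t).
  by exists t; split=> //; apply: rt_refl.
have lt_v_t := inversions_left_rotation _ _ _ _ m_gt0 k_gt0 tv.
have mv : mary m v by rewrite (mary_right_rotation _ _ _ _ m_gt0 k_gt0 tv).
have [|//|u [mu nfu vu]] := IH v; first by lia.
exists u; split=> //; apply: rt_trans vu.
by apply: rt_step; right.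
Qed.

(** * Recovering a normal form from its counts modulo k *)

(* [short_runs k r w]: every maximal run of [true]s in [w] is followed by
   [false] and is shorter than [k], the first run being counted with [r] extra
   [true]s in front of it. *)
Fixpoint short_runs (k r : nat) (w : seq bool) : bool :=
  match w with
  | [::] => r == 0
  | true :: w' => short_runs k r.+1 w'
  | false :: w' => (r < k) && short_runs k 0 w'
  end.

(** A first child prolongs the run of its parent, while every later sibling follows a leaf and
    starts a new run; the two halves of the list statement treat these cases. *)
Lemma short_runs_code (k r : nat) (t : tree) (w : seq bool) :
    short_spines k t ->
  short_runs k r (code t ++ w) = (r + spine t < k) && short_runs k 0 w.
Proof.
move: t r w; apply: (tree_seq_ind _ (fun s =>
  all (short_spines k) s -> (forall w, all (fun u => spine u < k) s ->
    short_runs k 0 (flatten (map code s) ++ w) = short_runs k 0 w) /\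
  (forall r w, all (fun u => spine u < k) (behead s) -> s <> [::] ->
    short_runs k r (flatten (map code s) ++ w)
    = (r + spine (head (Node [::]) s) < k) && short_runs k 0 w))) => //.
- move=> [|x s] IH r w; first by rewrite /= addn0.
  case/andP => short /IH[_ {}IH].
  by rewrite code_node // [LHS]/= IH //= addSnnS.
- move=> t s IHt IHs /= /andP[/IHt{}IHt /IHs[{}IHs _]].
  split=> [w|r w]; first by case/andP=> lt_t short; rewrite -catA IHt lt_t IHs.
  by move=> short _; rewrite -catA IHt IHs.
Qed.

(** Splits off the initial run, the only one that may have length [k] or more. *)
Lemma code_spine (k : nat) (t : tree) (w : seq bool) :
    short_spines k t -> short_runs k 0 w ->
  exists w', code t ++ w = nseq (spine t) true ++ false :: w'
    /\ short_runs k 0 w'.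
Proof.
have tail s v : all (short_spines k) s -> all (fun u => spine u < k) s ->
    short_runs k 0 v -> short_runs k 0 (flatten (map code s) ++ v).
  elim: s => //= x s IH /andP[nx ns] /andP[lx ls] sv.
  by rewrite -catA short_runs_code // lx IH.
move: t w; apply: (tree_seq_ind _ (fun s => if s is x :: _ then forall w,
  short_spines k x -> short_runs k 0 w ->
  exists w', code x ++ w = nseq (spine x) true ++ false :: w'
    /\ short_runs k 0 w' else True)) => //.
move=> [|x s] IH w; first by exists w.
case/andP => /= lt_s /andP[nx ns] sw.
have [|w' [E sw']] := IH (flatten (map code s) ++ w) nx; first exact: tail.
by exists w'; rewrite -catA E.
Qed.

(** Such a word cannot end inside a run, so without a [false] it is empty and no run is pending. *)
Lemma short_runs_trues_before (k r q : nat) (w : seq bool) :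
    short_runs k r w ->
  if trues_before q w is [::] then r = 0 /\ w = [::] else
  exists b v, [/\ w = nseq b true ++ false :: v, r + b < k
                & short_runs k 0 v].
Proof.
elim: w r q => [|[] w IH] r q /=; first by move/eqP.
  move=> /(IH _ q.+1); case: trues_before => [[]//|_ _ [b [v [-> lt_b sv]]]].
  by exists b.+1, v; rewrite addnS -addSn.
by case/andP=> lt_r sw; exists 0, w; rewrite addn0.
Qed.

(** A run shorter than [k] is determined by its length modulo [k]. The pending [r] and [r'] letters
    are already counted in [q] and [q']; the congruence says, without subtraction, that the counts
    agree where the current runs began. *)
Lemma short_runs_inj (k r r' q q' : nat) (w w' : seq bool) :
    short_runs k r w -> short_runs k r' w' -> q + r' = q' + r %[mod k] ->
    trues_mod k q w = trues_mod k q' w' ->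
  nseq r true ++ w = nseq r' true ++ w'.
Proof.
elim: w r r' q q' w' => [|[] w IH] r r' q q' w'.
- move=> /eqP-> /(short_runs_trues_before _ _ q').
  by rewrite /trues_mod; case: trues_before => [[-> ->]|].
- move=> /= sw sw' E Ew; rewrite nseq_true_cons.
  by apply: IH sw sw' _ Ew; rewrite addSn -addn1 -modnDml E modnDml addn1 addnS.
- case/andP=> lt_r sw /(short_runs_trues_before _ _ q') sw' E Ew.
  move: sw' (Ew); rewrite /trues_mod.
  case: trues_before => // _ _ [b [v [Ew' lt_b sv]]] _.
  move: Ew; rewrite Ew' /trues_mod trues_before_nseq /= => -[Eq Ev].
  have Er : r = r' + b.
    (* Both run lengths are below [k], so congruence suffices. *)
    rewrite -(modn_small lt_r) -(modn_small lt_b); apply/eqP.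
    rewrite -(eqn_modDl q') -E addnCA addnC.
    by rewrite -modnDmr Eq modnDmr.
  have /= -> := IH 0 0 q (q' + b) v sw sv _ Ev; last by rewrite !addn0.
  by rewrite catA -nseqD -Er.
Qed.

Lemma short_spines_unique (m k : nat) (t t' : tree) :
    1 < m -> mary m t -> mary m t' -> short_spines k t -> short_spines k t' ->
    trues_mod k 0 (code t) = trues_mod k 0 (code t') ->
  t = t'.
Proof.
move=> m_gt1 mt mt' nt nt' E.
have [//|w [Et sw]] := code_spine k t [::] nt.
have [//|w' [Et' sw']] := code_spine k t' [::] nt'.
rewrite cats0 in Et; rewrite cats0 in Et'.
have szE : count negb (code t) = count negb (code t').
  by have := congr1 size E; rewrite !size_map !size_trues_before.
(* Equal numbers of leaves force equal numbers of inner nodes, as [m - 1] is positive; this will fix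
   the initial run, which the residues leave open. *)
have ctE : count id (code t) = count id (code t').
  by move: szE; rewrite (count_code _ _ mt) (count_code _ _ mt'); nia.
have Ew : w = w'.
  move: E; rewrite Et Et' /trues_mod !trues_before_nseq /= !add0n => -[Eq Ew].
  by apply: (short_runs_inj k 0 0 _ _ w w' sw sw' _ Ew); rewrite !addn0.
have Es : spine t = spine t'.
  by move: ctE; rewrite Et Et' Ew !count_cat !count_true_nseq; lia.
by have [|//] := code_inj_cat t t' [::] [::] mt mt';
  rewrite !cats0 Et Et' Ew Es.
Qed.

(** * Weighted depths and codes *)

(** An edge labelled l_i weighs the number of siblings to the right of its lower end. *)
Definition path_weight (m : nat) (w : seq nat) : nat :=
  \sum_(1 <= i < m) (m - i) * count_mem i w.

Lemma path_weight_cons (m i : nat) (w : seq nat) : 0 < i ->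
  path_weight m (i :: w) = (m - i) + path_weight m w.
Proof.
move=> i_gt0; rewrite /path_weight /=.
under eq_bigr do rewrite mulnDr.
rewrite big_split /=; congr (_ + _).
have [lt_i_m|le_m_i] := ltnP i m.
  rewrite (big_cat_nat _ (n := i)) //=; last exact: ltnW.
  rewrite (big_ltn lt_i_m) eqxx muln1.
  rewrite big_nat_cond big1 => [|j]; last by rewrite andbT; lia.
  rewrite big_nat_cond big1 => [|j]; last by rewrite andbT; lia.
  by rewrite addn0.
(* For [m <= i] the truncated difference [m - i] is 0, and [i] is outside the range of summation. *)
rewrite big_nat_cond big1 => [|j]; last by rewrite andbT; lia.
by lia.
Qed.

Lemma weighted_delta (m j : nat) (t : tree) : j < leaves t ->
  \sum_(1 <= i < m) (m - i) * nth 0 (delta i t) j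
  = nth 0 (map (path_weight m) (leaf_paths t)) j.
Proof.
move=> lt_j; rewrite (nth_map [::]) //.
by apply: eq_bigr => i _; rewrite (nth_map [::]).
Qed.

Fixpoint add_positions (a : nat) (s : seq nat) : seq nat :=
  if s is x :: s' then (a + x) :: add_positions a.+1 s' else [::].

Lemma add_positions_cat (a : nat) (s s' : seq nat) :
  add_positions a (s ++ s')
  = add_positions a s ++ add_positions (a + size s) s'.
Proof.
by elim: s a => [|x s IH] a /=; rewrite ?addn0 // IH addSnnS.
Qed.

Lemma size_add_positions (a : nat) (s : seq nat) :
  size (add_positions a s) = size s.
Proof. by elim: s a => //= x s IH a; rewrite IH. Qed.

Lemma nth_add_positions (a j : nat) (s : seq nat) : j < size s ->
  nth 0 (add_positions a s) j = a + j + nth 0 s j.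
Proof.
elim: s a j => // x s IH a [|j] lt_j /=; first by rewrite addn0.
by rewrite IH // addSnnS.
Qed.

(** The list of paths in [leaf_paths] with an arbitrary first label, as needed for induction along
    the siblings. *)
Definition paths_from (i : nat) (s : seq tree) : seq (seq nat) :=
  flatten [seq [seq p.1 :: w | w <- p.2]
          | p <- zip (iota i (size s)) [seq leaf_paths u | u <- s]].

(* [a] leaves and [q] inner nodes precede the tree in a larger one, and [r] is
   the weight of the path leading to its root. *)
Lemma path_weight_code (m a q r : nat) (t : tree) :
    mary m t -> r + a = (m - 1) * q ->
  add_positions a [seq r + path_weight m w | w <- leaf_paths t]
  = [seq (m - 1) * x | x <- trues_before q (code t)].
Proof.
(* The weight [r] counts the subtrees pending to the right. Together with the [a] leaves passed and
   the current subtree they number [1 + (m - 1) * q], whence the invariant. For siblings, [r] is the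
   weight of the parent and [m - i] counts those after the first of [s]. *)
move=> mt; move: t mt a q r; apply: (tree_seq_ind _ (fun s => all (mary m) s ->
  forall i a q r, 0 < i -> i + size s = m.+1 ->
  r + (m - i) + a = (m - 1) * q ->
  add_positions a [seq r + path_weight m w | w <- paths_from i s]
  = [seq (m - 1) * x | x <- trues_before q (flatten (map code s))])).
- move=> [|x s] IH mt a q r E.
    rewrite /= /path_weight big1 => [|i _]; last by rewrite muln0.
    by rewrite addn0 addnC E.
  have [//|sz ms] := mary_nodeP mt.
  rewrite code_node // [RHS]/= -(IH ms 1 a q.+1 r) //.
    by rewrite sz add1n.
  by rewrite mulnS -E; lia.
- by [].
- move=> t s IHt IHs /= /andP[mt ms] i a q r i_gt0 sz E.
  rewrite /paths_from /= -/(paths_from _ _) map_cat add_positions_cat.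
  rewrite trues_before_cat map_cat -map_comp.
  have Et := IHt mt a q (r + (m - i)) E.
  have Ep : [seq r + path_weight m w | w <- [seq i :: w | w <- leaf_paths t]]
      = [seq r + (m - i) + path_weight m w | w <- leaf_paths t].
    rewrite -map_comp; apply: eq_map => w /=.
    by rewrite path_weight_cons // addnA.
  have szt : size (leaf_paths t) = count negb (code t).
    have := congr1 size Et.
    by rewrite size_add_positions !size_map size_trues_before.
  rewrite map_comp Ep Et size_map szt (count_code _ _ mt); congr (_ ++ _).
  (* After the last sibling [i = m], and the invariant would fail for [i.+1] because [m - i.+1]
     truncates to 0; the empty list is treated apart. *)
  case: s => [|y s] in ms sz IHs *; first by [].
  apply: IHs => //; first by move: sz => /=; lia.
  by move: sz; rewrite mulnDr -E /=; lia.
Qed.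

Lemma path_weight_code0 (m : nat) (t : tree) : mary m t ->
  add_positions 0 (map (path_weight m) (leaf_paths t))
  = [seq (m - 1) * x | x <- trues_before 0 (code t)].
Proof. by move=> mt; rewrite -(path_weight_code m 0 0 0 t mt) // muln0. Qed.

Lemma leaves_code (m : nat) (t : tree) :
  mary m t -> leaves t = size (trues_before 0 (code t)).
Proof.
move=> /path_weight_code0 /(congr1 size).
by rewrite size_add_positions !size_map.
Qed.

Lemma weighted_delta_code (m j : nat) (t : tree) :
    mary m t -> j < leaves t ->
  j + \sum_(1 <= i < m) (m - i) * nth 0 (delta i t) j
  = (m - 1) * nth 0 (trues_before 0 (code t)) j.
Proof.
move=> mt lt_j; rewrite weighted_delta //.
have /(congr1 (fun s => nth 0 s j)) := path_weight_code0 m t mt.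
rewrite nth_add_positions ?size_map // add0n => ->.
by rewrite (nth_map 0) // -(leaves_code m t mt).
Qed.

Theorem theorem2p16 (m k g n : nat) (hm : 2 <= m) (hk : 1 <= k)
  (hn : n = m + g * (m - 1)) (t t' : tree)
  (ht : mary m t) (ht' : mary m t')
  (htn : leaves t = n) (htn' : leaves t' = n) :
  k_equivalent m k t t' <->
  (forall j : 'I_n,
     \sum_(1 <= i < m) (m - i) * nth 0 (delta i t) j
     = \sum_(1 <= i < m) (m - i) * nth 0 (delta i t') j %[mod k * (m - 1)]).
Proof.
have m_gt0 : 0 < m by lia.
have sz := leaves_code m t ht; have sz' := leaves_code m t' ht'.
have modE (j : nat) : j < n ->
    (\sum_(1 <= i < m) (m - i) * nth 0 (delta i t) j
     == \sum_(1 <= i < m) (m - i) * nth 0 (delta i t') j %[mod k * (m - 1)])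
    = (nth 0 (trues_mod k 0 (code t)) j == nth 0 (trues_mod k 0 (code t')) j).
  (* Adding [j] turns both sums into multiples of [m - 1], a factor that cancels with that of the
     modulus. *)
  move=> lt_j; rewrite -(eqn_modDl j) !weighted_delta_code ?htn ?htn' //.
  rewrite [k * _]mulnC -!muln_modr eqn_pmul2l; last by lia.
  by rewrite !(nth_map 0) // -?sz -?sz' ?htn ?htn'.
split=> [tt' j|E].
  apply/eqP; rewrite modE //.
  by rewrite (trues_mod_k_equivalent m k t t').
have Emod : trues_mod k 0 (code t) = trues_mod k 0 (code t').
  apply: (@eq_from_nth _ 0);
    rewrite !size_map -sz -?sz' ?htn ?htn' // => j lt_j.
  by apply/eqP; rewrite -modE //; apply/eqP; apply: (E (Ordinal lt_j)).
have [u [mu nu tu]] := short_spines_exists m k t m_gt0 hk ht.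
have [u' [mu' nu' tu']] := short_spines_exists m k t' m_gt0 hk ht'.
have Eu : u = u'.
  apply: (short_spines_unique m k) => //.
  by rewrite -(trues_mod_k_equivalent m k t u) // Emod
    (trues_mod_k_equivalent m k t' u').
by apply: rt_trans tu _; rewrite Eu; apply: k_equivalent_sym.
Qed.
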